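(* Let $w\in\mathbb R^n$ be an $L$-generic direction, and let $\Lambda\in\mathfrak L_\beta$ satisfy $\mathcal B_w(\Lambda)\ne\emptyset$. Then $\mathrm{rank}_{\mathbb Q}(B_{E_\Lambda})=r$. Equivalently, the linear map $B_{E_\Lambda}:\mathbb Q^{r}\to\mathbb Q^{E_\Lambda}$ is injective.
   Context: $[n]=\{1,\dots,n\}$. $A\in\mathrm{Mat}_{d\times n}(\mathbb Z)$ has rank $d$, $\beta\in\mathbb C^d$, $L=\mathrm{Ker}_{\mathbb Z}(A)$, $r=n-d$. $B\in\mathrm{Mat}_{n\times r}(\mathbb Z)$ is a matrix whose columns form a $\mathbb Z$-basis of $L$; for $E\subset[n]$, $B_E$ is the submatrix of rows indexed by $E$ (if $r=0$, every row submatrix has column rank zero). An exponent lattice is a coset $\Lambda=\lambda+L$ with $\lambda\in\mathbb C^n$, $A\lambda=\beta$; $\mathfrak L_\beta$ is the set of all of them. $E_\Lambda=\{j\in[n]\mid\lambda_j\in\mathbb Z\}$ (independent of $\lambda\in\Lambda$). $\mathrm{nsupp}(\gamma)=\{j\in[n]\mid\gamma_j\in\mathbb Z_{<0}\}$; $\Lambda_I=\{\gamma\in\Lambda\mid\mathrm{nsupp}(\gamma)=I\}$; $\mathrm{NS}(\Lambda)=\{I\subset[n]\mid\Lambda_I\ne\emptyset\}$. $w$ is $L$-generic if $w\cdot u\ne0$ for all $u\in L\setminus\{0\}$. $\mathcal B_w(\Lambda)$ is the set of $I\in\mathrm{NS}(\Lambda)$ such that $\{w\cdot(\gamma-\lambda)\mid\gamma\in\Lambda_I\}$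 is bounded below in $\mathbb R$ (for one, equivalently any, $\lambda\in\Lambda$). *)

(* Defs.v *)
From HB Require Import structures.
From mathcomp Require Import all_boot all_order all_algebra.
From mathcomp Require Import boolp classical_sets reals.
From mathcomp Require Import complex.

Set Implicit Arguments.
Unset Strict Implicit.
Unset Printing Implicit Defensive.

Import Order.TTheory GRing.Theory Num.Theory.

Local Open Scope classical_set_scope.
Local Open Scope complex_scope.
Local Open Scope ring_scope.

(* The index set [n] = {1, ..., n} is 'I_n = {0, ..., n-1}, and vectors are
   column vectors. The complex numbers are R[i] for an arbitrary R : realType. *)

Definition dot (K : comNzRingType) (n : nat) (v x : 'cV[K]_n) : K :=
  \sum_(j < n) v j 0 * x j 0.

Definition matQ (m n : nat) (M : 'M[int]_(m, n)) : 'M[rat]_(m, n) :=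
  map_mx intr M.

Definition kerZ (d n : nat) (A : 'M[int]_(d, n)) : set 'cV[int]_n :=
  [set u | A *m u = 0].

Definition Zbasis_of_kerZ (d n r : nat) (A : 'M[int]_(d, n))
    (B : 'M[int]_(n, r)) : Prop :=
  (forall k : 'I_r, kerZ A (col k B)) /\
  (forall u, kerZ A u -> exists! c : 'cV[int]_r, B *m c = u).

(* Rows are taken in increasing order of their index in E. *)
Definition row_submx (T : Type) (n r : nat) (B : 'M[T]_(n, r))
    (E : {set 'I_n}) : 'M[T]_(#|E|, r) :=
  \matrix_(i < #|E|, k < r) B (enum_val i) k.

Section Lattices.
Variables (R : realType) (d n : nat).
Implicit Types (A : 'M[int]_(d, n)) (w : 'cV[R]_n) (Lam : set 'cV[R[i]]_n).

Definition L_generic A w : Prop :=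
  forall u, kerZ A u -> u != 0 -> dot w (map_mx intr u) != 0.

Definition exponent_lattices A (beta : 'cV[R[i]]_d) : set (set 'cV[R[i]]_n) :=
  [set Lam | exists2 lam : 'cV[R[i]]_n,
     map_mx intr A *m lam = beta &
     Lam = [set lam + map_mx intr u | u in kerZ A]].

(* For an exponent lattice, all its points give the same set:
   see integral_coordsE. *)
Definition integral_coords Lam : {set 'I_n} :=
  [set j | `[< exists2 lam, Lam lam & exists z : int, lam j 0 = z%:~R >]]%SET.

Definition nsupp (gam : 'cV[R[i]]_n) : {set 'I_n} :=
  [set j | `[< exists2 z : int, z < 0 & gam j 0 = z%:~R >]]%SET.

Definition stratum Lam (I : {set 'I_n}) : set 'cV[R[i]]_n :=
  [set gam | Lam gam /\ nsupp gam = I].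

Definition NS Lam : set {set 'I_n} := [set I | stratum Lam I !=set0].

(* Differences gam - lam of points of an exponent lattice are integer vectors,
   so the complex number w . (gam - lam) is real and Re loses nothing. *)
Definition weights w Lam (I : {set 'I_n}) (lam : 'cV[R[i]]_n) : set R :=
  [set complex.Re (dot (map_mx (real_complex R) w) (gam - lam))
     | gam in stratum Lam I].

(* The base point is immaterial: see bounded_below_indep. *)
Definition bounded_NS w Lam : set {set 'I_n} :=
  [set I | NS Lam I /\ exists2 lam, Lam lam & has_lbound (weights w Lam I lam)].

Lemma integral_coordsE A beta Lam (lam : 'cV[R[i]]_n) :
  exponent_lattices A beta Lam -> Lam lam ->
  integral_coords Lam = [set j | `[< exists z : int, lam j 0 = z%:~R >]]%SET.
Proof.
move=> [l0 _ ->] [u Lu <-]; apply/setP => j; rewrite !inE.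
apply/asboolP/asboolP => [[_ [v _ <-]] [z]|[z zE]]; last first.
  by exists (l0 + map_mx intr u); [exists u|exists z].
rewrite !mxE => zE; exists (z - v j 0 + u j 0).
by rewrite rmorphD rmorphB /= -zE addrK.
Qed.

Lemma weight_real A beta Lam w (lam gam : 'cV[R[i]]_n) :
  exponent_lattices A beta Lam -> Lam lam -> Lam gam ->
  exists x : R, dot (map_mx (real_complex R) w) (gam - lam) = x%:C.
Proof.
move=> [l0 _ ->] [u _ <-] [v _ <-]; exists (dot w (map_mx intr (v - u))).
rewrite /dot rmorph_sum; apply: eq_bigr => j _.
by rewrite !mxE opprD addrACA subrr add0r rmorphM /= rmorph_int rmorphB.
Qed.

Lemma bounded_below_indep w Lam (I : {set 'I_n}) (lam mu : 'cV[R[i]]_n) :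
  has_lbound (weights w Lam I lam) -> has_lbound (weights w Lam I mu).
Proof.
set f := fun x => complex.Re (dot (map_mx (real_complex R) w) x).
have fD x y : f (x + y) = f x + f y.
  rewrite /f; set v := map_mx _ w.
  have -> : dot v (x + y) = dot v x + dot v y.
    rewrite /dot -big_split; apply: eq_bigr => j _.
    by rewrite [(x + y) _ _]mxE mulrDr.
  by case: (dot v x) (dot v y) => [? ?] [? ?].
move=> [m mP]; exists (m + f (lam - mu)) => _ [gam gamI <-].
have le_m : m <= f (gam - lam) by apply: mP; exists gam.
change (m + f (lam - mu) <= f (gam - mu)).
have -> : gam - mu = (gam - lam) + (lam - mu) by rewrite addrA subrK.
by rewrite [leRHS]fD lerD2r.
Qed.

End Lattices.

(* Main.v *)
Require Import Defs.
From mathcomp Require Import all_boot all_order all_algebra.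
From mathcomp Require Import boolp classical_sets reals.
From mathcomp Require Import complex.
Import Order.TTheory GRing.Theory Num.Theory.
Local Open Scope classical_set_scope.
Local Open Scope ring_scope.

(** The rank condition fails exactly when some nonzero [u] in the lattice
    [L = Ker_Z A] vanishes on every coordinate at which [Lam] is integral: a
    rational vector killed by the rows [B_E] can be scaled to an integer vector
    [c], and [u = B c].  Adding a multiple of such a [u] to a point of [Lam]
    only moves coordinates that are not integers, and they stay non-integers;
    so every stratum of [Lam] is invariant under translation by [Z u]
    ([stratum_shift]).  As [w] is [L]-generic, [w . u] is nonzero, so the weights
    on a nonempty stratum contain a two-sided arithmetic progression of nonzero
    step and cannot be bounded below ([bounded_NS_vanish]).  Hence a single
    bounded stratum forces [u = 0], and then [c = 0] because the columns of [B]
    are a basis. *)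

Lemma clear_denominators (n : nat) (x : 'cV[rat]_n) :
  exists2 a : int, a != 0 &
    exists c : 'cV[int]_n, a%:~R *: x = map_mx intr c.
Proof.
exists (\prod_i denq (x i 0)).
  by apply/prodf_neq0 => i _; rewrite denq_eq0.
exists (\col_j (numq (x j 0) * \prod_(i | i != j) denq (x i 0))).
apply/colP => j; rewrite !mxE (bigD1 j) //= !rmorphM /= mulrAC; congr (_ * _).
by rewrite numqE mulrC.
Qed.

(** A coset of [Ker_Z A] is closed under translation by [u]; membership of a
    negative integer at coordinate [j] is unaffected since either [u] is zero
    there or the coordinate is, before and after, not an integer. *)
Lemma stratum_shift (R : realType) (d n : nat) (A : 'M[int]_(d, n))
    (beta : 'cV[R[i]]_d) (Lam : set 'cV[R[i]]_n) (I : {set 'I_n})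
    (gam : 'cV[R[i]]_n) (u : 'cV[int]_n) :
  exponent_lattices A beta Lam -> kerZ A u ->
  (forall j, j \in integral_coords Lam -> u j 0 = 0) ->
  stratum Lam I gam -> stratum Lam I (gam + map_mx intr u).
Proof.
move=> LamP Lu u0 [Lgam <-]; split.
  case: LamP Lgam => [l0 _ ->] [v Lv <-]; exists (v + u).
    by rewrite /kerZ /= mulmxDr Lv Lu addr0.
  by rewrite map_mxD addrA.
have gamE := integral_coordsE LamP Lgam.
apply/setP => j; rewrite !inE !mxE.
have [jE|jNE] := boolP (j \in integral_coords Lam).
  by rewrite u0 // addr0.
have gamN z : gam j 0 <> z%:~R.
  by move=> gz; move: jNE; rewrite gamE inE => /asboolP; apply; exists z.
apply/asboolP/asboolP => [] [z _ zE]; exfalso; last exact: gamN zE.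
by apply: (gamN (z - u j 0)); rewrite rmorphB /= -zE addrK.
Qed.

Lemma weight_shift (R : realType) (n : nat) (w : 'cV[R]_n)
    (x : 'cV[R[i]]_n) (u : 'cV[int]_n) :
  complex.Re (dot (map_mx (real_complex R) w) (x + map_mx intr u)) =
  complex.Re (dot (map_mx (real_complex R) w) x) + dot w (map_mx intr u).
Proof.
have -> : dot (map_mx (real_complex R) w) (x + map_mx intr u) =
    dot (map_mx (real_complex R) w) x + (real_complex R) (dot w (map_mx intr u)).
  rewrite /dot rmorph_sum -big_split; apply: eq_bigr => j _.
  by rewrite !mxE mulrDr rmorphM /= rmorph_int.
by case: (dot _ x).
Qed.

(** All integer translates of one point of the bounded stratum along [u] stay in
    it, and their weights [f + k (w . u)] have a common lower bound over all
    integers [k] only if [w . u = 0]; genericity then gives [u = 0]. *)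
Lemma bounded_NS_vanish (R : realType) (d n : nat) (A : 'M[int]_(d, n))
    (beta : 'cV[R[i]]_d) (w : 'cV[R]_n) (Lam : set 'cV[R[i]]_n)
    (u : 'cV[int]_n) :
  L_generic A w -> exponent_lattices A beta Lam -> bounded_NS w Lam !=set0 ->
  kerZ A u -> (forall j, j \in integral_coords Lam -> u j 0 = 0) -> u = 0.
Proof.
move=> hw LamP [I [[gam gamI] [lam _ [m mP]]]] Lu u0.
apply/eqP; apply: contraT => /(hw u Lu).
set t := dot w _ => t0; exfalso.
set f := complex.Re (dot (map_mx (real_complex R) w) (gam - lam)).
have le_m (k : int) : m <= f + k%:~R * t.
  have -> : k%:~R * t = dot w (map_mx intr (k *: u)).
    rewrite /t /dot mulr_sumr; apply: eq_bigr => j _.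
    by rewrite !mxE rmorphM /= mulrCA.
  rewrite -weight_shift addrAC; apply: mP.
  exists (gam + map_mx intr (k *: u)) => //; apply: stratum_shift gamI => //.
  - exact: LamP.
  - by rewrite /kerZ /= -scalemxAr Lu scaler0.
  - by move=> j /u0 uj; rewrite mxE uj mulr0.
(* The sign of t decides on which side of (m - f) / t the integer k must lie
     for k * t < m - f. *)
have [t_gt0|t_lt0|t_eq0] := ltgtP 0 t; last by rewrite -t_eq0 eqxx in t0.
  have := le_m (Num.floor ((m - f) / t) - 1); rewrite leNgt => /negP; apply.
  rewrite -ltrBrDl -ltr_pdivlMr // rmorphB /= ltrBlDr.
  by rewrite (le_lt_trans (floor_le _)) // ltrDl.
have := le_m (Num.floor ((m - f) / t) + 1); rewrite leNgt => /negP; apply.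
by rewrite -ltrBrDl -ltr_ndivrMr // floorD1_gt.
Qed.

Lemma row_submx_mul (T : pzSemiRingType) (n r : nat) (B : 'M[T]_(n, r))
    (E : {set 'I_n}) (c : 'cV[T]_r) (j : 'I_n) (jE : j \in E) :
  (row_submx B E *m c) (enum_rank_in jE j) 0 = (B *m c) j 0.
Proof.
by rewrite !mxE; apply: eq_bigr => k _; rewrite !mxE enum_rankK_in.
Qed.

Theorem lemma4p1 (R : realType) (d n : nat)
    (A : 'M[int]_(d, n)) (hA : \rank (matQ A) = d)
    (beta : 'cV[R[i]]_d)
    (B : 'M[int]_(n, n - d)) (hB : Zbasis_of_kerZ A B)
    (w : 'cV[R]_n) (hw : L_generic A w)
    (Lam : set 'cV[R[i]]_n) (hLam : exponent_lattices A beta Lam)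
    (hne : bounded_NS w Lam !=set0) :
  let BE := matQ (row_submx B (integral_coords Lam)) in
  \rank BE = (n - d)%N /\
  injective (fun x : 'cV[rat]_(n - d) => BE *m x).
Proof.
move=> BE.
have AB0 : A *m B = 0.
  apply/trmx_inj/row_matrixP => k; apply/trmx_inj.
  by rewrite -!tr_col !trmxK colE -mulmxA -colE hB.1 linear0.
have ker0 (x : 'cV[rat]_(n - d)) : BE *m x = 0 -> x = 0.
  move=> BEx; have [a a0 [c xc]] := clear_denominators _ x.
  have LBc : kerZ A (B *m c) by rewrite /kerZ /= mulmxA AB0 mul0mx.
  have BEc : row_submx B (integral_coords Lam) *m c = 0.
    have BEc0 : map_mx intr (row_submx B (integral_coords Lam) *m c)
        = 0 :> 'cV[rat]_ _.
      by rewrite map_mxM -xc -scalemxAr BEx scaler0.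
    apply/colP => i; apply: (@intr_inj rat).
    by move/colP: BEc0 => /(_ i); rewrite [LHS]mxE !mxE.
  have Bc0 : B *m c = 0.
    apply: bounded_NS_vanish hw hLam hne LBc _ => j jE.
    by rewrite -(row_submx_mul _ _ _ _ _ _ _ jE) BEc mxE.
  have [c' [_ c'U]] := hB.2 _ LBc.
  have c0 : c = 0 by rewrite -(c'U c) // (c'U 0) // mulmx0 Bc0.
  move/eqP: xc; rewrite c0 map_mx0 scaler_eq0 intr_eq0 (negPf a0) /=.
  by move/eqP.
split; last first.
  move=> x y /= xy; apply/eqP; rewrite -subr_eq0; apply/eqP/ker0.
  by rewrite mulmxBr xy subrr.
rewrite -mxrank_tr; apply/eqP; apply: inj_row_free => v vBE.
apply: trmx_inj; rewrite trmx0; apply: ker0.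
by rewrite -[BE]trmxK -trmx_mul vBE trmx0.
Qed.
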